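(* Let $G$ be a finite simple non-complete connected graph on the vertex set $[n]=\{1,\ldots,n\}$. Then \[ f(G)+\operatorname{diam}(G)\leq n+2-\kappa(G). \] In particular, \[ 3\leq f(G)+\operatorname{diam}(G)+\kappa(G)\leq n+2. \]
   Context: For a finite simple connected graph $G$ on $[n]$: the distance of two distinct vertices is the smallest length (number of edges) of a path in $G$ connecting them, and $\operatorname{diam}(G)$ is the maximum of all such distances. $\kappa(G)$ denotes the vertex connectivity: for non-complete $G$, the smallest cardinality of a subset $T\subset[n]$ such that the induced subgraph of $G$ on $[n]\setminus T$ is disconnected. A vertex $i$ is free (simplicial) if whenever $\{i,j\},\{i,j'\}\in E(G)$ with $j\neq j'$, then $\{j,j'\}\in E(G)$. $f(G)$ denotes the number of free vertices of $G$. *)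

(* Defs.v *)
(* A finite simple graph on a finite vertex type T is given by its edge
   relation e : rel T, assumed symmetric and irreflexive. *)
From mathcomp Require Import all_boot.

Set Implicit Arguments.
Unset Strict Implicit.
Unset Printing Implicit Defensive.

Section GraphInvariants.

Variables (T : finType) (e : rel T).

Definition complete : bool := [forall x, forall y, (x != y) ==> e x y].

Definition induced (A : {set T}) : rel T :=
  [rel x y | [&& x \in A, y \in A & e x y]].

(* The empty induced subgraph counts as connected; this does not affect
   [kappa], since the default value there is below #|T| when T is nonempty. *)
Definition connected_on (A : {set T}) : bool :=
  [forall x in A, forall y in A, connect (induced A) x y].

Definition connected : bool := connected_on [set: T].

(* In MathComp, [path e x p] allows repeated vertices; [uniq] makes it a path
   in the graph-theoretic sense. Its length (number of edges) is d = size p. *)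
Definition joined_by_path (x y : T) (d : nat) : bool :=
  [exists p : d.-tuple T, [&& path e x p, last x p == y & uniq (x :: p)]].

(* A path has at most #|T|.-1 edges, so all candidate lengths are < #|T|; the
   default #|T| is only attained when no path joins x and y. *)
Definition dist (x y : T) : nat :=
  \big[minn/#|T|]_(d < #|T| | joined_by_path x y d) d.

Definition diam : nat := \max_(x : T) \max_(y : T | y != x) dist x y.

(* Default value: the usual convention #|T|.-1 for complete graphs. In a
   non-complete graph, removing all vertices but two non-adjacent ones
   disconnects, so the minimum is at most #|T| - 2 and the default plays no
   role. *)
Definition kappa : nat :=
  \big[minn/#|T|.-1]_(S : {set T} | ~~ connected_on (~: S)) #|S|.

Definition free (i : T) : bool :=
  [forall j, forall k, [&& e i j, e i k & j != k] ==> e j k].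

Definition nb_free : nat := #|[set i | free i]|.

End GraphInvariants.

(* Main.v *)
(** Fix [x], [y] at distance [d = diam], and for [0 < i < d] let [M_i] be the set
    of vertices at distance [i] from [x] having a neighbour at distance [i + 1].
    Removing [M_i] separates [x] from [y], so [M_i] has at least [kappa]
    elements; and no vertex of [M_i] is free, since it has a neighbour at
    distance [i - 1] and one at distance [i + 1]. The [M_i] being disjoint, at
    least [(d - 1) kappa >= d + kappa - 2] vertices are not free. *)
Require Import Defs.
From mathcomp Require Import all_boot.
From mathcomp Require Import zify.

Lemma bigminn_leq_cond (I : finType) (P : pred I) (F : I -> nat) (m : nat) i :
  P i -> \big[minn/m]_(j | P j) F j <= F i.
Proof.
move=> Pi; elim: (index_enum I) (mem_index_enum i) => // j r IHr.
rewrite in_cons big_cons => /predU1P[<-|/IHr le_i]; first by rewrite Pi geq_minl.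
by case: ifP => // _; apply: leq_trans le_i; apply: geq_minr.
Qed.

Section Distance.

Variables (T : finType) (e : rel T).

(** Shortening a walk to a repetition-free path only drops vertices, so distances can be bounded by
    arbitrary walks. *)
Lemma dist_leq_path x p : path e x p -> dist e x (last x p) <= size p.
Proof.
move=> e_p; case: (shortenP e_p) => q e_q uniq_q /uniq_leq_size le_qp.
have lt_q : size q < #|T|.
  by rewrite -[(size q).+1]/(size (x :: q)) -(card_uniqP uniq_q) max_card.
apply: leq_trans (le_qp _); last by case/andP: uniq_q.
apply: (@bigminn_leq_cond _ _ _ _ (Ordinal lt_q)) => /=.
by apply/existsP; exists (in_tuple q); rewrite /= e_q eqxx.
Qed.

Hypothesis e_conn : connected e.

Lemma dist_path x y :
  exists p, [/\ path e x p, last x p = y & size p = dist e x y].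
Proof.
have [p e_p ->] : exists2 p, path e x p & y = last x p.
  move/forall_inP/(_ x (in_setT x))/forall_inP/(_ y (in_setT y)): e_conn.
  by case/connectP=> p e_p ->; exists p => //; apply: sub_path e_p => u v /and3P[].
have lt_d : dist e x (last x p) < #|T|.
  case: (shortenP e_p) => q e_q uniq_q _; apply: leq_ltn_trans (dist_leq_path _ _ e_q) _.
  by rewrite -[(size q).+1]/(size (x :: q)) -(card_uniqP uniq_q) max_card.
(* A minimum is either its default value or attained; the path [p] has just excluded the default. *)
suff : dist e x (last x p) = #|T| \/ exists q,
    [/\ path e x q, last x q = last x p & size q = dist e x (last x p)].
  by case=> // d_eq; rewrite d_eq ltnn in lt_d.
rewrite /dist; elim/big_ind: _ => [|m1 m2 IH1 IH2|d].
- by left.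
- by case: (leqP m1 m2).
- case/existsP=> q /and3P[e_q /eqP q_last _]; right; exists q.
  by rewrite size_tuple.
Qed.

Lemma dist_refl x : dist e x x = 0.
Proof. by apply/eqP; rewrite -leqn0; apply: (dist_leq_path x [::]). Qed.

Lemma dist_edge x u v : e u v -> dist e x v <= (dist e x u).+1.
Proof.
move=> e_uv; have [p [e_p p_last <-]] := dist_path x u.
have := dist_leq_path x (rcons p v).
by rewrite rcons_path last_rcons size_rcons e_p p_last; apply.
Qed.

(** The penultimate vertex of a shortest path from [x] to [u] serves as [w]. *)
Lemma dist_pred x u :
  0 < dist e x u -> exists2 w, e w u & dist e x w < dist e x u.
Proof.
have [p [e_p p_last <-]] := dist_path x u.
case/lastP: p => // p v in e_p p_last *.
move: e_p p_last; rewrite rcons_path last_rcons => /andP[e_p e_v] <- _.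
by exists (last x p) => //; rewrite size_rcons ltnS dist_leq_path.
Qed.

Lemma dist_nonadjacent x y : x != y -> ~~ e x y -> 1 < dist e x y.
Proof.
move=> /eqP neq_xy /negP e'xy; have [p [e_p p_last <-]] := dist_path x y.
by case: p => [|u [|v p]] //= in e_p p_last *; case/andP: e_p; rewrite p_last.
Qed.

Lemma kappa_leq (S : {set T}) : ~~ connected_on e (~: S) -> kappa e <= #|S|.
Proof. exact: (@bigminn_leq_cond _ _ (fun S : {set T} => #|S|)). Qed.

(** The default [#|T|.-1] is positive, and a separating set is nonempty because the graph itself is
    connected. *)
Lemma kappa_gt0 : 1 < #|T| -> 0 < kappa e.
Proof.
move=> T_gt1; rewrite /kappa; elim/big_ind: _ => [|m1 m2|S].
- by rewrite -ltnS prednK // ltnW.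
- by rewrite leq_min => -> ->.
- by apply: contraNltn; rewrite leqn0 cards_eq0 => /eqP->; rewrite setC0.
Qed.

(** The set [M_i]. Not the whole sphere of radius [i]: a vertex without a neighbour further out
    could be free. *)
Definition exits (x : T) (i : nat) : {set T} :=
  [set u | (dist e x u == i) && [exists v, e u v && (dist e x v == i.+1)]].

(** Along an edge the distance from [x] grows by at most one, and it can pass from [i] to [i + 1]
    only by leaving a vertex of [M_i]. A walk from [x] avoiding [M_i] thus stays within distance
    [i]. *)
Lemma exits_separate x y i :
  0 < i < dist e x y -> ~~ connected_on e (~: exits x i).
Proof.
case/andP=> i_gt0 lt_iy; apply/negP.
have x_in : x \in ~: exits x i.
  by rewrite !inE dist_refl; case: i i_gt0 {lt_iy}.
have y_in : y \in ~: exits x i by rewrite !inE gtn_eqF.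
move/forall_inP/(_ x x_in)/forall_inP/(_ y y_in)/connectP=> -[p e_p y_last].
suff : dist e x (last x p) <= i by rewrite -y_last leqNgt lt_iy.
have : dist e x x <= i by rewrite dist_refl.
(* Only the start of the walk is generalized; [x] stays the point from which distances are
   measured. *)
elim: p {2 4 6}x e_p {y_last} => //= v p IHp u /andP[/and3P[u_in _ e_uv] e_p] le_ui.
apply: IHp e_p _; have := dist_edge x _ _ e_uv.
move: u_in; rewrite !inE => /nandP[|/existsPn/(_ v)]; last rewrite e_uv; lia.
Qed.

Hypothesis e_sym : symmetric e.

Lemma exits_not_free x i u : 0 < i -> u \in exits x i -> ~~ free e u.
Proof.
move=> i_gt0; rewrite inE => /andP[/eqP dist_u /existsP[v /andP[e_uv /eqP dist_v]]].
have [|w e_wu dist_w] := dist_pred x u; first by rewrite dist_u.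
apply/negP=> /forallP/(_ w)/forallP/(_ v); rewrite e_sym e_wu e_uv /=.
have -> : w != v by apply/eqP=> eq_wv; rewrite eq_wv in dist_w; lia.
(* If [u] were free, [w] and [v] would be adjacent, yet their distances from [x] differ by at least
   two. *)
by move/(dist_edge x); lia.
Qed.

Lemma card_not_free_geq x y :
  (dist e x y).-1 * kappa e <= #|[set u | ~~ free e u]|.
Proof.
(* Counting only within distance [k] keeps the next layer [M_(k+1)] disjoint from what is already
   counted. *)
suff IH k : k < dist e x y ->
    k * kappa e <= #|[set u | ~~ free e u & dist e x u <= k]|.
  case d_eq: (dist e x y) => [|d] //=.
  apply: leq_trans (IH d _) _; first by rewrite d_eq.
  by apply/subset_leq_card/subsetP=> u; rewrite !inE => /andP[].
elim: k => // k IHk lt_k.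
have le_exits := kappa_leq _ (exits_separate x y k.+1 lt_k).
rewrite mulSn addnC.
apply: leq_trans (leq_add (IHk (ltnW lt_k)) le_exits) _.
rewrite -cardsUI (_ : _ :&: _ = set0) ?cards0 ?addn0.
  apply/subset_leq_card/subsetP=> u; rewrite in_setU inE.
  case/orP=> [/andP[u_nf le_uk]|u_exit]; rewrite inE.
    by rewrite u_nf ltnW.
  rewrite (exits_not_free x k.+1) //=.
  by move: u_exit; rewrite inE => /andP[/eqP->].
apply/setP=> u; rewrite !inE; lia.
Qed.

Lemma diam_attained (x y : T) : x != y -> exists u v, diam e = dist e u v.
Proof.
move=> neq_xy; have T_gt0 : 0 < #|T| by apply/card_gt0P; exists x.
rewrite /diam; have [u ->] := eq_bigmax (fun u : T => \max_(v | v != u) dist e u v) T_gt0.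
(* The inner maximum is attained once some vertex differs from [u]; one of [x] and [y] does. *)
have [|v _ ->] := @eq_bigmax_cond _ (fun v => v != u) (dist e u); last by exists u, v.
apply/card_gt0P; have [eq_xu|neq_xu] := eqVneq x u; last by exists x.
by exists y; rewrite unfold_in /= -eq_xu eq_sym.
Qed.

Lemma dist_leq_diam x y : x != y -> dist e x y <= diam e.
Proof.
rewrite eq_sym => neq_yx; apply: leq_trans (leq_bigmax x).
exact: (@leq_bigmax_cond _ (fun v => v != x)).
Qed.

End Distance.

Theorem theorem1p1 (n : nat) (e : rel 'I_n)
    (e_sym : symmetric e) (e_irr : irreflexive e)
    (e_conn : connected e) (e_noncomplete : ~~ complete e) :
  nb_free e + diam e <= n + 2 - kappa e /\
  3 <= nb_free e + diam e + kappa e <= n + 2.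
Proof.
have [x [y [neq_xy e'xy]]] : exists x y, x != y /\ ~~ e x y.
  case/forallPn: e_noncomplete => x /forallPn[y].
  by rewrite negb_imply => /andP[]; exists x, y.
have diam_gt1 : 1 < diam e.
  exact: leq_trans (dist_nonadjacent _ _ e_conn _ _ neq_xy e'xy) (dist_leq_diam _ _ _ _ neq_xy).
have kappa_pos : 0 < kappa e.
  apply: kappa_gt0 => //; apply/card_gt1P; by exists x, y.
have [u [v diam_eq]] := diam_attained _ e _ _ neq_xy.
have := card_not_free_geq _ e e_conn e_sym u v; rewrite -diam_eq.
have := cardsC [set i | free e i]; rewrite card_ord -/(nb_free e).
have -> : ~: [set i | free e i] = [set i | ~~ free e i].
  by apply/setP=> i; rewrite !inE.
(* With [d = diam e], the product [(d - 2) (kappa - 1) >= 0] gives [(d - 1) kappa >= d + kappa - 2].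
   The lower bound 3 comes from [d >= 2] and [kappa >= 1]. *)
nia.
Qed.
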